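(* Let $X$ and $Y$ be Hausdorff spaces and let $f:X\to Y$ be a continuous surjection that is boundary-compact. If $X\in\Omega$, then $f$ is a sequentially quotient map if and only if $f$ is a pseudo-sequence-covering map.
   Context: $\Omega$ denotes the class of all topological spaces $X$ such that every compact subset $K\subset X$ is metrizable and has a countable neighborhood base in $X$ (a countable family of open sets containing $K$ such that every open set containing $K$ contains a member of the family). A map $f:X\to Y$ is *boundary-compact* if for each $y\in Y$ the topological boundary $\partial f^{-1}(y)$ is compact in $X$. $f$ is *sequentially quotient* if whenever $\{y_n\}$ is a convergent sequence in $Y$ there are a subsequence $\{y_{n_k}\}$ and a convergent sequence $\{x_k\}$ in $X$ with $x_k\in f^{-1}(y_{n_k})$ for each $k$. $f$ is *pseudo-sequence-covering* if for each convergent sequence $L$ in $Y$ there is a compact subset $K$ of $X$ such that $f(K)=\overline{L}$ (the closure of the set of terms of $L$, i.e. the terms together with the limit). *)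

(* Defs.v *)
From HB Require Import structures.
From mathcomp Require Import all_boot all_order all_algebra.
From mathcomp Require Import all_classical reals topology metric_structure.
From mathcomp Require Import sequences.

Set Implicit Arguments.
Unset Strict Implicit.
Unset Printing Implicit Defensive.

Local Open Scope classical_set_scope.

Definition homeomorphism (S T : topologicalType) (h : S -> T) : Prop :=
  continuous h /\
  exists g : T -> S, [/\ continuous g, cancel h g & cancel g h].

Definition metrizable (R : realType) (T : topologicalType) : Prop :=
  exists (M : metricType R) (h : T -> M), homeomorphism h.

Definition countable_nbhs_base (X : topologicalType) (K : set X) : Prop :=
  exists2 B : set (set X), countable B &
    (forall U, B U -> open U /\ K `<=` U) /\
    (forall U, open U -> K `<=` U -> exists2 V, B V & V `<=` U).

(* [set_type K] carries the topology induced by the inclusion into [X]; the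
   library's [subspace K] would instead be a topology on all of [X]. *)
Definition Omega (R : realType) (X : topologicalType) : Prop :=
  forall K : set X, compact K ->
    metrizable R (set_type K) /\ countable_nbhs_base K.

Definition boundary (X : topologicalType) (A : set X) : set X :=
  closure A `\` interior A.

Definition boundary_compact (X Y : topologicalType) (f : X -> Y) : Prop :=
  forall y : Y, compact (boundary (f @^-1` [set y])).

(* Stated without the library's [lim], which requires a pointed space. *)
Definition convergent_seq (T : topologicalType) (u : nat -> T) : Prop :=
  exists l : T, u @ \oo --> l.

Definition sequentially_quotient (X Y : topologicalType) (f : X -> Y) : Prop :=
  forall y : nat -> Y, convergent_seq y ->
    exists (s : nat -> nat) (x : nat -> X),
      [/\ increasing_seq s, convergent_seq x & forall k, f (x k) = y (s k)].

Definition pseudo_sequence_covering (X Y : topologicalType) (f : X -> Y)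
    : Prop :=
  forall y : nat -> Y, convergent_seq y ->
    exists2 K : set X, compact K & f @` K = closure (range y).

(* Main.v *)
(* Let [y] converge to [l] and let [B] be the boundary of the fibre of [l], a
   compact set with a decreasing countable base [U m] of open neighbourhoods.
   If [f] is sequentially quotient, then for each [m] all but finitely many
   fibres of terms [y n <> l] meet [U m]: otherwise a subsequence of such terms
   lifts to a convergent sequence avoiding [U m], whose limit lies in the fibre
   of [l] but not in its interior, hence in [B]. So the terms lift to points
   converging to [B], and adjoining these points to [B] keeps it compact.
   Conversely, lift the terms of [y] into a compact set; points of [X] have
   countable bases, so some subsequence converges to a given cluster point. *)
Require Import Defs.
From mathcomp Require Import all_boot all_order all_algebra.
From mathcomp Require Import all_classical reals topology metric_structure.
From mathcomp Require Import sequences.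

Local Open Scope classical_set_scope.

(** The predicate may vary with [k], so the demands can tighten along the subsequence. Each index is
    sought from the successor of the previous one on. *)
Lemma increasing_seq_choice (P : nat -> nat -> Prop) :
  (forall k N, exists2 n, (N <= n)%N & P k n) ->
  exists2 s : nat -> nat, increasing_seq s & forall k, P k (s k).
Proof.
move=> infP.
have [g gP] : {g : nat -> nat -> nat |
    forall k N, (N <= g k N)%N /\ P k (g k N)}.
  apply: cid; have /choice[g gP] : forall kN : nat * nat,
      exists n, (kN.2 <= n)%N /\ P kN.1 n.
    by move=> [k N]; have [n] := infP k N; exists n.
  by exists (fun k N => g (k, N)) => k N; exact: gP (k, N).
pose s := fix s k := if k is j.+1 then g k (s j).+1 else g 0%N 0%N.
exists s; last by case=> [|k]; exact: (gP _ _).2.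
by apply/increasing_seqP => k; exact: (gP _ _).1.
Qed.

Lemma increasing_seq_cvg (s : nat -> nat) :
  increasing_seq s -> s @ \oo --> \oo.
Proof.
move=> s_incr A [N _ NA]; exists N => // n /= Nn; apply: NA => /=.
by rewrite (leq_trans Nn)// unstable.mono_leq_infl.
Qed.

Lemma countable_nbhs_base_seq {X : topologicalType} {K : set X} :
  countable_nbhs_base K ->
  exists U : nat -> set X, [/\ forall n, open (U n), forall n, K `<=` U n,
    forall m n, (m <= n)%N -> U n `<=` U m &
    forall O, open O -> K `<=` O -> exists n, U n `<=` O].
Proof.
move=> [B /pfcard_geP[B0|[e]] [B_open B_base]].
  (* An empty base is impossible: some member must lie inside the whole space. *)
  by have [] := B_base setT openT (@subsetT _ _) => V; rewrite B0.
have eB n : B (e n) by exact: funS.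
(* Finite intersections of the enumerated members make the base decreasing. *)
pose U := fix U n := if n is m.+1 then U m `&` e n else e 0%N.
have U_sub n : U n `<=` e n by case: n => [//|n] x [].
exists U; split.
- elim=> [|n IHn]; first exact: (B_open _ (eB _)).1.
  by apply: openI => //; exact: (B_open _ (eB _)).1.
- elim=> [|n IHn]; first exact: (B_open _ (eB _)).2.
  by rewrite subsetI; split => //; exact: (B_open _ (eB _)).2.
- move=> m n /subnK <-; elim: (n - m)%N => [//|k IHk].
  by apply: subset_trans IHk => x [].
- move=> O O_open KO; have [V BV VO] := B_base O O_open KO.
  have [n _ en] := 'surj_e BV.
  by exists n; apply: subset_trans VO; rewrite -en.
Qed.

(* A filter on [K] either clusters in [A] or has a member whose closure misses
   [A], and then it lives on a finite set. Covers are avoided since the library's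
   [compact_cover] requires a pointed space. *)
Lemma compact_almost_covered {X : topologicalType} {A K : set X} :
  compact A -> A `<=` K ->
  (forall O, open O -> A `<=` O -> finite_set (K `\` O)) -> compact K.
Proof.
move=> A_compact AK finKO F FF FK.
have [F_meets|/existsNP[S /not_implyP[FS /set0P/negP/negPn/eqP SA0]]] :=
    pselect (forall S, F S -> closure S `&` A !=set0).
  (* A cluster point of [G] lies in the closure of [closure S] for every [S] in [F], so it is also a
     cluster point of [F]. *)
  pose G := filter_from F (fun S => closure S `&` A).
  have GF : ProperFilter G.
    apply: filter_from_proper => //; apply: filter_from_filter.
      by exists K.
    move=> S T FS FT; exists (S `&` T); first exact: filterI.
    move=> x [STx Ax]; do 2 split=> //.
      by apply: closureS STx => ? [].
    by apply: closureS STx => ? [].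
  have GA : G A by exists K => // x [].
  have [a [Aa clGa]] := A_compact G GF GA.
  exists a; split; first exact: AK.
  rewrite clusterE => S FS; apply: closed_closure.
  move=> V aV; have GS : G (closure S `&` A) by exists S.
  by have [x [[Sx _] Vx]] := clGa _ _ GS aV; exists x.
have A_sub : A `<=` ~` closure S.
  by move=> x Ax clSx; have : (closure S `&` A) x by []; rewrite SA0.
have KS_fin := finKO _ (closed_openC (@closed_closure _ S)) A_sub.
have FKS : F (K `\` ~` closure S).
  apply: filterS (filterI FK FS) => x [Kx Sx]; split=> //.
  by apply; exact: subset_closure.
have [x [[Kx _] clFx]] := finite_compact KS_fin FF FKS.
by exists x.
Qed.

Section CoverAndLift.
Context {X Y : topologicalType} {f : X -> Y}.

Lemma pseudo_sequence_covering_sequentially_quotient :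
  (forall x : X, countable_nbhs_base [set x]) ->
  pseudo_sequence_covering f -> sequentially_quotient f.
Proof.
move=> X_first_countable f_cover y y_cvg.
have [K K_compact fK] := f_cover y y_cvg.
have /choice[x xP] : forall n, exists x, K x /\ f x = y n.
  move=> n; have : (f @` K) (y n) by rewrite fK; apply: subset_closure; exists n.
  by move=> [x Kx fx]; exists x.
have xK : (x @ \oo) K by exists 0%N => // n _; exact: (xP n).1.
have [p [Kp clp]] := K_compact (x @ \oo) _ xK.
have [U [U_open pU U_decr U_base]] := countable_nbhs_base_seq (X_first_countable p).
(* Since [p] is a cluster point, every tail of [x] meets every [U k]. *)
have [k N|s s_incr sU] := @increasing_seq_choice (fun k n => U k (x n)).
  have xN : (x @ \oo) (x @` [set n | (N <= n)%N]).
    by exists N => // n Nn; exists n.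
  have pUk : nbhs p (U k) by apply: open_nbhs_nbhs; split=> //; exact: pU.
  by have [_ [[n Nn <-] Un]] := clp _ _ xN pUk; exists n.
exists s, (x \o s); split=> //; last by move=> k; exact: (xP _).2.
exists p => V; rewrite nbhsE => -[O [O_open Op] OV].
have [|m UO] := U_base O O_open; first by move=> _ ->.
by exists m => // n /= mn; apply/OV/UO/(U_decr m n).
Qed.

Hypotheses (hausdorffY : hausdorff_space Y) (f_continuous : continuous f).

Lemma boundary_lift_limit {y : nat -> Y} {l : Y} {x : nat -> X} {z : X} :
  y @ \oo --> l -> x @ \oo --> z -> (forall n, f (x n) = y n) ->
  (forall n, y n <> l) -> boundary (f @^-1` [set l]) z.
Proof.
move=> y_l x_z fxy y_neq.
have fzl : f z = l.
  apply: (cvg_unique hausdorffY _ y_l) => /=.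
  rewrite (_ : y = f \o x); last by apply/funext => n /=.
  by apply: cvg_comp x_z _; exact: f_continuous.
split; first exact: subset_closure.
(* If the fibre were a neighbourhood of [z], it would contain a tail of [x], forcing [y N = l]. *)
move=> /x_z[N _ Nl]; apply: (y_neq N).
by rewrite -fxy; exact: Nl (leqnn N).
Qed.

Lemma fibres_meet_boundary_nbhs {y : nat -> Y} {l : Y} {U : set X} :
  sequentially_quotient f -> y @ \oo --> l ->
  open U -> boundary (f @^-1` [set l]) `<=` U ->
  exists N, forall n, (N <= n)%N -> y n <> l -> exists2 x, U x & f x = y n.
Proof.
move=> f_sq y_l U_open BU; apply: contrapT => /forallNP noN.
have [k N|s s_incr sP] := @increasing_seq_choice
    (fun=> [set n | y n <> l /\ forall x, f x = y n -> ~ U x]).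
  have /existsNP[n /not_implyP[Nn /not_implyP[ynl noUx]]] := noN N.
  by exists n => //; split=> // x fx Ux; apply: noUx; exists x.
have ys_l : y \o s @ \oo --> l by exact: cvg_comp (increasing_seq_cvg _ s_incr) y_l.
have [t [x [t_incr [z x_z] fx]]] := f_sq (y \o s) (ex_intro _ l ys_l).
(* The bad terms [y (s k)] lift only along a further subsequence [t]. *)
have yst_l := cvg_comp _ _ (increasing_seq_cvg _ t_incr) ys_l.
have Bz : boundary (f @^-1` [set l]) z.
  by apply: boundary_lift_limit yst_l x_z fx _ => n; exact: (sP _).1.
have [N _ NU] := x_z _ (open_nbhs_nbhs (conj U_open (BU _ Bz))).
exact: (sP (t N)).2 (x N) (fx N) (NU N (leqnn N)).
Qed.

Lemma sequentially_quotient_pseudo_sequence_covering :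
  set_surj [set: X] [set: Y] f -> boundary_compact f ->
  (forall y : Y, countable_nbhs_base (boundary (f @^-1` [set y]))) ->
  sequentially_quotient f -> pseudo_sequence_covering f.
Proof.
move=> f_surj f_bc B_countable f_sq y [l y_l].
set B := boundary (f @^-1` [set l]).
have [U [U_open BU U_decr U_base]] := countable_nbhs_base_seq (B_countable l).
have /choice[N NP] m := fibres_meet_boundary_nbhs f_sq y_l (U_open m) (BU m).
have fiber z : exists x, f x = z by have [x _ <-] := f_surj z I; exists x.
(* The point [x n] is to lie in every [U m] already available at [n], that is with [N m <= n]. The
   cutoff [m < n] leaves finitely many such [m]; as [U] decreases, the largest one decides, whence
   the induction on the cutoff. *)
have /choice[x xP] : forall n, exists x, f x = y n /\
    forall m, (m < n)%N -> (N m <= n)%N -> y n <> l -> U m x.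
  move=> n; suff: forall k, exists x, f x = y n /\
      forall m, (m < k)%N -> (N m <= n)%N -> y n <> l -> U m x by exact.
  elim=> [|k [x [fx xU]]].
    by have [x fx] := fiber (y n); exists x.
  have [[Nk ynl]|noU] := pselect ((N k <= n)%N /\ y n <> l).
    have [x' Ux' fx'] := NP k n Nk ynl; exists x'; split=> // m mk _ _.
    exact: U_decr Ux'.
  exists x; split=> // m; rewrite ltnS leq_eqVlt => /predU1P[->|mk] Nm ynl.
    by exfalso; apply: noU.
  exact: xU.
(* [B] may be empty, for instance when the fibre of [l] is open; [p] ensures that [l] is in the
   image of [K]. *)
have [p fp] := fiber l.
pose K := B `|` [set p] `|` x @` [set n | y n <> l].
have fB z : B z -> f z = l.
  move=> [clz _]; suff : closed (f @^-1` [set l]) by exact.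
  apply: preimage_closed => [u _|]; first exact: f_continuous.
  exact/accessible_closed_set1/hausdorff_accessible.
have K_compact : compact K.
  apply: (compact_almost_covered (f_bc l)) => [z|O O_open BO]; first by do 2 left.
  have [m UO] := U_base O O_open BO.
  (* From index [maxn m.+1 (N m)] on, the lifts of terms other than [l] lie in [U m], hence in
     [O]. *)
  apply: (@sub_finite_set _ _ ([set p] `|` x @` `I_(maxn m.+1 (N m)))).
    move=> z [[[/BO //|zp]|[n ynl <-]] nOz]; [by left|right; exists n => //=].
    rewrite ltnNge geq_max; apply/negP => /andP[mn Nn].
    by apply/nOz/UO; exact: (xP n).2.
  by rewrite finite_setU; split=> //; exact/finite_image/finite_II.
exists K => //; apply/seteqP; split=> [_ [z Kz <-]|].
  have cl_l : closure (range y) l.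
    move=> V /y_l[M _ MV]; exists (y M); split; first by exists M.
    exact: MV (leqnn M).
  case: Kz => [[/fB -> //|-> ]|[n _ <-]]; first by rewrite fp.
  by rewrite (xP n).1; apply: subset_closure; exists n.
(* As the image is closed, it suffices that it contains the terms of [y]. *)
have fK_closed : closed (f @` K).
  apply: compact_closed => //; apply: continuous_compact => //.
  exact: continuous_subspaceT.
rewrite [X in _ `<=` X](closure_id _).1//; apply: closureS => _ [n _ <-].
have [->|ynl] := pselect (y n = l); first by exists p => //; left; right.
by exists (x n); [right; exists n|exact: (xP n).1].
Qed.

End CoverAndLift.

Theorem theorem3p11 (R : realType) (X Y : topologicalType) (f : X -> Y)
    (hausdorffX : hausdorff_space X) (hausdorffY : hausdorff_space Y)
    (f_continuous : continuous f)
    (f_surjective : set_surj [set: X] [set: Y] f)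
    (f_boundary_compact : boundary_compact f)
    (X_Omega : Omega R X) :
  sequentially_quotient f <-> pseudo_sequence_covering f.
Proof.
split.
  apply: sequentially_quotient_pseudo_sequence_covering => // y.
  exact: (X_Omega _ (f_boundary_compact y)).2.
apply: pseudo_sequence_covering_sequentially_quotient => // x.
by have [] := X_Omega [set x] (@compact_set1 X x).
Qed.
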